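(* (Soundness.) For every set of formulas $\Phi\cup\{\varphi\}$ of the logic $\mathit{S5BKE}$: if $\Phi\vdash\varphi$, then $\Phi\Vdash\varphi$.
   Context: Language: formulas $Fm$ are built from propositional variables $V=\{x_0,x_1,\dots\}$ with the connectives $\neg,\rightarrow$ and unary operators $\square$ (evidence), $K$ (knowledge), $B$ (belief); $\wedge,\vee,\leftrightarrow,\top,\bot$ are the usual classical abbreviations. Axioms of $\mathit{S5BKE}$ (all instances of): (i) every formula having the form of a classical propositional tautology; (ii) $K\varphi\rightarrow\varphi$; (iii) $K\varphi\rightarrow B\varphi$; (iv) $\square\varphi\rightarrow\square\square\varphi$; (v) $\neg\square\varphi\rightarrow\square\neg\square\varphi$; (vi) $\square\varphi\rightarrow K\varphi$; (vii) $K(\varphi\rightarrow\psi)\rightarrow(K\varphi\rightarrow K\psi)$; (viii) $B(\varphi\rightarrow\psi)\rightarrow(B\varphi\rightarrow B\psi)$; (ix) $\square(\varphi\rightarrow\psi)\rightarrow(\square\varphi\rightarrow\square\psi)$; (x) $\neg B\bot$. Rules: modus ponens, and axiom necessitation (if $\varphi$ is an axiom, infer $\square\varphi$). $\Phi\vdash\varphi$ means there is a finite sequence ending in $\varphi$ each member of which is in $\Phi$, an axiom, obtained by modus ponens from earlier members, or is $\square\psi$ for an earlier member $\psi$ that is an axiom. Algebraic semantics: a model is $\mathcal{M}=(M,\mathit{TRUE},\vee,\wedge,\neg,0,1,\square,B,K)$ where $(M,\vee,\wedge,\neg,0,1)$ is a Boolean algebra, $\mathit{TRUE}$ is an ultrafilter,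 and $\square,B,K:M\to M$ satisfy: (1) $\square a=1$ if $a=1$ and $\square a=0$ otherwise; (2) for every ultrafilter $U$, the sets $\mathit{KNOW}(U)=\{a\in M: Ka\in U\}$ and $\mathit{BEL}(U)=\{a\in M: Ba\in U\}$ are proper filters with $\mathit{KNOW}(U)\subseteq U\cap\mathit{BEL}(U)$. An assignment $\gamma:V\to M$ extends homomorphically to $Fm$ (with $\gamma(\neg\varphi)=\neg\gamma(\varphi)$, $\gamma(\varphi\rightarrow\psi)=\neg\gamma(\varphi)\vee\gamma(\psi)$, $\gamma(\square\varphi)=\square\gamma(\varphi)$, $\gamma(K\varphi)=K\gamma(\varphi)$, $\gamma(B\varphi)=B\gamma(\varphi)$). $(\mathcal{M},\gamma)\vDash\varphi$ iff $\gamma(\varphi)\in\mathit{TRUE}$. $\Phi\Vdash\varphi$ iff every interpretation $(\mathcal{M},\gamma)$ satisfying all formulas of $\Phi$ satisfies $\varphi$. *)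

(* Defs.v *)
From HB Require Import structures.
From mathcomp Require Import all_boot all_order.
From mathcomp Require Import classical_sets.

Set Implicit Arguments.
Unset Strict Implicit.
Unset Printing Implicit Defensive.

Local Open Scope classical_set_scope.

Inductive form : Type :=
  | Var of nat
  | Neg of form
  | Imp of form & form
  | Box of form
  | Know of form
  | Bel of form.

(* The primitive connectives are Neg and Imp only; the constants are the
   abbreviations x_0 -> x_0 and its negation. *)
Definition Top : form := Imp (Var 0) (Var 0).
Definition Bot : form := Neg Top.

Inductive pform : Type :=
  | PVar of nat
  | PNeg of pform
  | PImp of pform & pform.

Fixpoint peval (v : nat -> bool) (p : pform) : bool :=
  match p with
  | PVar n => v n
  | PNeg q => ~~ peval v q
  | PImp q r => peval v q ==> peval v r
  end.

Definition tautology (p : pform) : Prop := forall v, peval v p.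

Fixpoint psubst (s : nat -> form) (p : pform) : form :=
  match p with
  | PVar n => s n
  | PNeg q => Neg (psubst s q)
  | PImp q r => Imp (psubst s q) (psubst s r)
  end.

(* "Having the form of a tautology": a substitution instance, by arbitrary
   (possibly modal) formulas, of a purely propositional tautology. *)
Inductive is_axiom : form -> Prop :=
  | Ax_taut p s of tautology p : is_axiom (psubst s p)
  | Ax_KT a : is_axiom (Imp (Know a) a)
  | Ax_KB a : is_axiom (Imp (Know a) (Bel a))
  | Ax_box4 a : is_axiom (Imp (Box a) (Box (Box a)))
  | Ax_box5 a : is_axiom (Imp (Neg (Box a)) (Box (Neg (Box a))))
  | Ax_boxK a : is_axiom (Imp (Box a) (Know a))
  | Ax_Kdistr a b :
      is_axiom (Imp (Know (Imp a b)) (Imp (Know a) (Know b)))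
  | Ax_Bdistr a b :
      is_axiom (Imp (Bel (Imp a b)) (Imp (Bel a) (Bel b)))
  | Ax_boxdistr a b :
      is_axiom (Imp (Box (Imp a b)) (Imp (Box a) (Box b)))
  | Ax_Bcons : is_axiom (Neg (Bel Bot)).

Definition justified (Phi : set form) (s : seq form) (i : nat) : Prop :=
  let f := nth Bot s in
  [\/ Phi (f i),
      is_axiom (f i),
      exists j k, [/\ j < i, k < i & f k = Imp (f j) (f i)]
    | exists j, [/\ j < i, is_axiom (f j) & f i = Box (f j)]].

Definition derives (Phi : set form) (phi : form) : Prop :=
  exists s : seq form,
    forall i, i < size (rcons s phi) -> justified Phi (rcons s phi) i.

Section Filters.
Context {d : Order.disp_t} {M : ctbDistrLatticeType d}.
Local Open Scope order_scope.

Record proper_filter (F : set M) : Prop := ProperFilter {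
  pfilter_top : F \top;
  pfilter_meet : forall a b : M, F a -> F b -> F (Order.meet a b);
  pfilter_up : forall a b : M, F a -> a <= b -> F b;
  pfilter_bot : ~ F \bot
}.

Definition ultrafilter (U : set M) : Prop :=
  proper_filter U /\
  forall F : set M, proper_filter F -> subset U F -> F = U.

Definition KNOW (know : M -> M) (U : set M) : set M := [set a | U (know a)].
Definition BEL (bel : M -> M) (U : set M) : set M := [set a | U (bel a)].

End Filters.

(* A Boolean algebra is a ctbDistrLatticeType: a bounded distributive lattice
   with complement. *)
Record model := Model {
  model_disp : Order.disp_t;
  carrier :> ctbDistrLatticeType model_disp;
  TRUE : set carrier;
  box : carrier -> carrier;
  bel : carrier -> carrier;
  know : carrier -> carrier;
  TRUE_ultra : ultrafilter TRUE;
  boxE : forall a : carrier, box a = (if a == \top then \top else \bot)%O;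
  KNOW_BEL : forall U : set carrier, ultrafilter U ->
    [/\ proper_filter (KNOW know U), proper_filter (BEL bel U)
      & KNOW know U `<=` U `&` BEL bel U]
}.

Fixpoint interp (M : model) (g : nat -> M) (phi : form) : M :=
  match phi with
  | Var n => g n
  | Neg a => Order.compl (interp g a)
  | Imp a b => Order.join (Order.compl (interp g a)) (interp g b)
  | Box a => box (interp g a)
  | Know a => know (interp g a)
  | Bel a => bel (interp g a)
  end.

Definition satisfies (M : model) (g : nat -> M) (phi : form) : Prop :=
  TRUE (interp g phi).

Definition entails (Phi : set form) (phi : form) : Prop :=
  forall (M : model) (g : nat -> M),
    (forall psi, Phi psi -> satisfies g psi) -> satisfies g phi.

(* Main.v *)
Require Import Defs.
From mathcomp Require Import all_boot all_order.
From mathcomp Require Import boolp classical_sets.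

(** The conditions on [know] and [bel] in a model constrain only their values
    modulo ultrafilters, so an axiom is first shown to denote an element of
    every ultrafilter, where the connectives become two-valued. By the
    ultrafilter theorem an element of all ultrafilters is the top element, and
    therefore [box] sends it to the top element: this validates axiom
    necessitation. *)

Set Implicit Arguments.
Unset Strict Implicit.
Unset Printing Implicit Defensive.

Import Order.Theory.
Section Ultrafilters.
Local Open Scope order_scope.
Local Open Scope classical_set_scope.
Context {d : Order.disp_t} {M : ctbDistrLatticeType d}.
Implicit Types (F G U : set M) (a b : M).

Lemma principal_proper_filter a :
  a != \bot -> proper_filter [set x : M | a <= x].
Proof.
move=> a0; split=> [|x y /= ax ay|x y /= ax xy|/=].
- exact: lex1.
- by rewrite lexI ax.
- exact: le_trans xy.
- by rewrite lex0; apply/negP.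
Qed.

Lemma proper_filter_mp F a b :
  proper_filter F -> F (~` a `|` b)%O -> F a -> F b.
Proof.
move=> fF Fab Fa; apply: (pfilter_up fF (pfilter_meet fF Fab Fa)).
by rewrite meetUl meetCx join0x leIl.
Qed.

Lemma proper_filter_sub_ultrafilter G :
  proper_filter G -> exists2 U, ultrafilter U & G `<=` U.
Proof.
move=> fG.
(* Taking the union with [G] makes the empty chain admissible in Zorn's lemma. *)
pose P := [set F | proper_filter (F `|` G)].
have [C PC totC|U [PU maxU]] := @Zorn_bigcup M P.
  rewrite /P /=; set W := (_ `|` G).
  have subW F : C F -> F `|` G `<=` W.
    by move=> CF x [Fx|Gx]; [left; exists F|right].
  (* Because [C] is a chain, two elements of [W] already lie in one proper filter inside [W]; each
     filter condition on [W] is then checked in that filter. *)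
  have common a b : W a -> W b ->
      exists F, [/\ proper_filter F, F `<=` W, F a & F b].
    have one x y F : C F -> F x -> G y ->
        exists F0, [/\ proper_filter F0, F0 `<=` W, F0 x & F0 y].
      move=> CF Fx Gy; exists (F `|` G).
      by split; [exact: PC|exact: subW|left|right].
    move=> [[F CF Fa]|Ga] [[F' CF' Fb]|Gb].
    - have [FF'|F'F] := totC _ _ CF CF'.
      + exists (F' `|` G).
        by split; [exact: PC|exact: subW|left; exact: FF'|left].
      + exists (F `|` G).
        by split; [exact: PC|exact: subW|left|left; exact: F'F].
    - exact: one Fa Gb.
    - by have [F0 [? ? ? ?]] := one _ _ _ CF' Fb Ga; exists F0.
    - by exists G; split=> // x Gx; right.
  split.
  - by right; exact: pfilter_top fG.
  - move=> a b Wa Wb; have [F [fF FW Fa Fb]] := common _ _ Wa Wb.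
    by apply: FW; exact: pfilter_meet.
  - move=> a b Wa ab; have [F [fF FW Fa _]] := common _ _ Wa Wa.
    by apply: FW; exact: pfilter_up ab.
  - move=> W0; have [F [fF _ F0 _]] := common _ _ W0 W0.
    exact: pfilter_bot F0.
have maxE F : U `<=` F -> P F -> F = U.
  move=> UF PF; apply: contrapT => FU; apply: (maxU F) => //.
  by rewrite properEneq; split=> //; apply/eqP => UE; apply: FU.
(* Adjoining [G] to [U] does not leave [P], so the maximal [U] has already absorbed [G]. *)
have UG : U `|` G = U.
  by apply: maxE => [x Ux|]; [left|rewrite /P /= -setUA setUid].
have GU : G `<=` U by rewrite -UG => x Gx; right.
exists U => //; split; first by rewrite -UG.
move=> F fF UF; apply: maxE => //; rewrite /P /=.
suff -> : F `|` G = F by [].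
by rewrite setUidl//; exact: subset_trans UF.
Qed.

(** Otherwise the complement of [a] is nonzero, and an ultrafilter extending its principal filter
    would contain both [a] and its complement. *)
Lemma in_all_ultrafilters_top a :
  (forall U, ultrafilter U -> U a) -> a = \top.
Proof.
move=> Ua; apply: contrapT => /eqP a1.
have na0 : (~` a)%O != \bot
  by apply: contra a1 => /eqP na0; rewrite -[a]complK na0 compl0.
have [U uU sU] := proper_filter_sub_ultrafilter (principal_proper_filter na0).
have [fU _] := uU; apply: (pfilter_bot fU); rewrite -(meetxC a).
by apply: pfilter_meet; [exact|exact: Ua|apply: sU => /=].
Qed.

Lemma ultrafilter_complE U a : ultrafilter U -> U (~` a)%O <-> ~ U a.
Proof.
move=> [fU maxU]; split=> [Una Ua|nUa].
  by apply: (pfilter_bot fU); rewrite -(meetxC a); exact: pfilter_meet.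
apply: contrapT => nUna; apply: nUa.
(* [F] is the filter generated by [U] and [a]. It is proper: if [u] meets [a] in bottom, then [u]
   lies below the complement of [a], which would then be in [U]. Maximality gives [F = U], hence [a]
   in [U]. *)
pose F := [set x | exists2 u, U u & (u `&` a)%O <= x].
suff <- : F = U by exists \top; [exact: pfilter_top fU|rewrite meet1x].
apply: maxU => [|u Uu]; last by exists u => //; exact: leIl.
split.
- by exists \top; [exact: pfilter_top fU|exact: lex1].
- move=> x y [u Uu ux] [v Uv vy]; exists (u `&` v)%O; first exact: pfilter_meet.
  rewrite lexI; apply/andP; split.
  + by apply: le_trans ux; rewrite leI2 ?leIl.
  + by apply: le_trans vy; rewrite leI2 ?leIr.
- by move=> x y [u Uu ux] xy; exists u => //; exact: le_trans xy.
- move=> [u Uu]; rewrite lex0 => /eqP ua0; apply: nUna.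
  by apply: (pfilter_up fU Uu); rewrite -disj_leC ua0.
Qed.

Lemma ultrafilter_impE U a b : ultrafilter U -> U (~` a `|` b)%O <-> (U a -> U b).
Proof.
move=> uU; have [fU _] := uU; split=> [|Uab].
  exact: proper_filter_mp.
have [Ua|/(ultrafilter_complE _ uU) Una] := pselect (U a).
- by apply: (pfilter_up fU (Uab Ua)); exact: leUr.
- by apply: (pfilter_up fU Una); exact: leUl.
Qed.

End Ultrafilters.

Section Soundness.
Local Open Scope order_scope.
Local Open Scope classical_set_scope.
Variables (M : model) (g : nat -> M).
Implicit Types U : set M.

Lemma box_top : box (\top : M) = \top.
Proof. by rewrite boxE eqxx. Qed.

(** [box] takes only the values top and bottom, so the choice of ultrafilter does not matter. *)
Lemma ultrafilter_boxE U (a : M) : ultrafilter U -> U (box a) <-> a = \top.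
Proof.
move=> [fU _]; rewrite boxE; case: eqP => [->|a1]; split=> //.
- by move=> _; exact: pfilter_top fU.
- by move=> /(pfilter_bot fU).
Qed.

(** Membership in an ultrafilter commutes with negation and implication, so it acts as a Boolean
    valuation of the substituted formulas. *)
Lemma ultrafilter_psubst U (s : nat -> form) (p : pform) : ultrafilter U ->
  U (interp g (psubst s p)) <-> peval (fun n => `[< U (interp g (s n)) >]) p.
Proof.
move=> uU; elim: p => [n|p IHp|p IHp q IHq] /=.
- by split=> [Un|/asboolP//]; apply/asboolP.
- rewrite ultrafilter_complE// IHp; split; first exact: introN idP.
  by move/negP.
- rewrite ultrafilter_impE// IHp IHq; split; first by move/implyP.
  by move/implyP.
Qed.

Lemma axiom_in_ultrafilter U (a : form) :
  ultrafilter U -> is_axiom a -> U (interp g a).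
Proof.
move=> uU; have [fK fB subK] := KNOW_BEL uU.
case=> [p s tp|b|b|b|b|b|b c|b c|b c|] /=.
- by apply/ultrafilter_psubst.
- by apply/ultrafilter_impE => // /subK[].
- by apply/ultrafilter_impE => // /subK[].
- apply/ultrafilter_impE => // /ultrafilter_boxE ->//.
  by rewrite !box_top; apply: pfilter_top; case: uU.
(* If the box is top, the antecedent is bottom and lies in no ultrafilter; if it is bottom, its
   complement is top, which [box] fixes. *)
- apply/ultrafilter_impE => //; rewrite boxE; case: eqP => _.
    by rewrite compl1 => U0; case: uU => fU _; case: (pfilter_bot fU).
  by rewrite compl0 box_top.
- by apply/ultrafilter_impE => // /ultrafilter_boxE ->//; exact: pfilter_top fK.
- apply/ultrafilter_impE => // Kbc; apply/ultrafilter_impE => //.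
  exact: proper_filter_mp fK Kbc.
- apply/ultrafilter_impE => // Bbc; apply/ultrafilter_impE => //.
  exact: proper_filter_mp fB Bbc.
- apply/ultrafilter_impE => // /ultrafilter_boxE bc.
  apply/ultrafilter_impE => // /ultrafilter_boxE b1.
  apply/ultrafilter_boxE => //; rewrite -bc// b1//.
  by rewrite compl1 join0x.
(* [Bot] denotes the complement of an excluded middle, that is, bottom, which the proper filter
   [BEL] omits. *)
- apply/ultrafilter_complE => //.
  by rewrite joinCx compl1; exact: pfilter_bot fB.
Qed.

Lemma axiom_interp_top (a : form) : is_axiom a -> interp g a = \top.
Proof.
by move=> axa; apply: in_all_ultrafilters_top => U uU; exact: axiom_in_ultrafilter.
Qed.

End Soundness.

Theorem theorem3p4 (Phi : set form) (phi : form) :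
  derives Phi phi -> entails Phi phi.
Proof.
move=> [s ders] M g gPhi; have uT := TRUE_ultra M.
suff sat i : i < size (rcons s phi) -> satisfies g (nth Bot (rcons s phi) i).
  by have := sat (size s); rewrite size_rcons nth_rcons ltnn eqxx; exact.
(* Strong induction, since modus ponens may refer to any earlier positions. *)
elim/ltn_ind: i => i IH ilt; have /= := ders i ilt.
case=> [/gPhi//|axi|[j [k [ji ki fk]]]|[j [ji axj ->]]].
- exact: axiom_in_ultrafilter.
- have := IH _ ki (ltn_trans ki ilt).
  rewrite fk => /(ultrafilter_impE _ _ uT); apply.
  exact: IH (ltn_trans ji ilt).
(* Mere truth of the axiom would not suffice here: [box] sends every element other than top to
   bottom. *)
- by rewrite /satisfies /= axiom_interp_top// box_top; case: uT => /pfilter_top.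
Qed.
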